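(* Let $G\subset\mathrm{GL}(n,\mathbb{C})$ be a (connected) simple algebraic group with Lie algebra $\mathfrak{g}\subset\mathfrak{gl}(n,\mathbb{C})$. Let $x,y\in\mathfrak{g}$ be nilpotent elements generating $\mathfrak{g}$ (as a Lie algebra). Let $t',s'\in\mathbb{C}$ be nonzero. Then the group $H=\langle\exp(t'x),\exp(s'y)\rangle$ is Zariski-dense in $G$.
   Context: Nilpotent elements are elements of $\mathfrak{g}$ that are nilpotent as $n\times n$ matrices, and $\exp$ is the matrix exponential. A simple algebraic group is in particular noncommutative, with simple Lie algebra. *)

(* Defs.v *)
From HB Require Import structures.
From mathcomp Require Import all_boot all_order all_algebra.
From mathcomp Require Import all_classical all_reals all_analysis.
From mathcomp Require Import complex.
From mathcomp Require mpoly.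

Set Implicit Arguments.
Unset Strict Implicit.
Unset Printing Implicit Defensive.

Import Order.TTheory GRing.Theory Num.Theory.
Import numFieldNormedType.Exports.
(* The notations of mpoly clash with those of mathcomp-analysis. *)
Import (canonicals) mpoly.

Local Open Scope classical_set_scope.
Local Open Scope ring_scope.

(* Polynomial functions of the entries of a square matrix; the entry (i, j) is
   the variable of index [mxvec_index i j]. *)
Section PolynomialFunctions.
Variables (K : fieldType) (n : nat).

Definition mxpoly_eval (A : 'M[K]_n) (p : mpoly.mpoly (n * n)%N K) : K :=
  mpoly.meval (fun k => mxvec A ord0 k) p.

(* Directional derivative: the differential of p at A applied to X. *)
Definition mxpoly_diff (A : 'M[K]_n) (p : mpoly.mpoly (n * n)%N K)
    (X : 'M[K]_n) : K :=
  \sum_(k < (n * n)%N) mxpoly_eval A (mpoly.mderiv k p) * mxvec X ord0 k.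

End PolynomialFunctions.

(* A copy of 'M[K]_n carrying the Zariski topology of affine n^2-space, so as not
   to interfere with the entrywise topology of matrices. *)
Definition zariski_mx (K : fieldType) (n : nat) : Type := 'M[K]_n.

Section ZariskiTopology.
Variables (K : fieldType) (n : nat).

HB.instance Definition _ := Choice.copy (zariski_mx K n) 'M[K]_n.

Definition zariski_open (U : set (zariski_mx K n)) : Prop :=
  exists S : set (mpoly.mpoly (n * n)%N K),
    ~` U = [set A | forall p, S p -> mxpoly_eval A p = 0].

Lemma zariski_openT : zariski_open setT.
Proof.
exists [set (1 : mpoly.mpoly (n * n)%N K)]; rewrite setCT.
apply/seteqP; split=> // A /(_ _ erefl).
by rewrite /mxpoly_eval mpoly.meval1 => /eqP; rewrite oner_eq0.
Qed.

Lemma zariski_openI : setI_closed zariski_open.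
Proof.
move=> U V [S US] [T VT].
exists [set r | exists p q, [/\ S p, T q & r = p * q]].
rewrite setCI US VT; apply/seteqP; split=> A /=.
  move=> AST _ [p [q [Sp Tq ->]]]; rewrite /mxpoly_eval mpoly.mevalM.
  by case: AST => [/(_ _ Sp)|/(_ _ Tq)];
    rewrite /mxpoly_eval => ->; rewrite ?mul0r ?mulr0.
move=> AST.
have [?|/existsNP [p /not_implyP [Sp Ap0]]] :=
  pselect (forall p, S p -> mxpoly_eval A p = 0); [by left | right=> q Tq].
have /eqP := AST (p * q) (ex_intro _ p (ex_intro _ q (And3 Sp Tq erefl))).
by rewrite /mxpoly_eval mpoly.mevalM mulf_eq0 => /orP[/eqP // | /eqP].
Qed.

Lemma zariski_open_bigU (I : Type) (f : I -> set (zariski_mx K n)) :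
  (forall i, zariski_open (f i)) -> zariski_open (\bigcup_i f i).
Proof.
move=> fop; exists [set p | exists i, forall A, ~ f i A -> mxpoly_eval A p = 0].
apply/seteqP; split=> A /=.
  by move=> nfA p [i fp]; apply: fp => fA; apply: nfA; exists i.
move=> Ap [i _]; have [S fS] := fop i.
suff : (~` f i) A by [].
rewrite fS => p Sp; apply: Ap; exists i => B nfB.
by have : (~` f i) B by []; rewrite fS; apply.
Qed.

HB.instance Definition _ := isOpenTopological.Build (zariski_mx K n)
  zariski_openT zariski_openI zariski_open_bigU.

End ZariskiTopology.

Section LinearAlgebraicGroups.
Variables (K : closedFieldType) (n : nat).
Implicit Types (G H N : set 'M[K]_n) (A B X Y : 'M[K]_n).

Definition gl_subgroup G : Prop :=
  [/\ forall A, G A -> A \in unitmx,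
      G 1%:M,
      forall A B, G A -> G B -> G (A *m B)
    & forall A, G A -> G (invmx A)].

Definition generated_subgroup (S : set 'M[K]_n) : set 'M[K]_n :=
  smallest gl_subgroup S.

(* GL_n is open in affine n^2-space and its Zariski topology as an affine variety
   is the subspace topology: its closed subsets are traces of closed sets. *)
Definition closed_in_gl G : Prop :=
  exists2 F : set (zariski_mx K n),
    closed F & G = F `&` [set A | A \in unitmx].

Definition algebraic_group G : Prop := gl_subgroup G /\ closed_in_gl G.

Definition zariski_connected G : Prop := @connected (zariski_mx K n) G.

Definition zariski_dense_in H G : Prop :=
  H `<=` G /\ G `<=` @closure (zariski_mx K n) H.

Definition normal_in N G : Prop :=
  N `<=` G /\ forall A B, G A -> N B -> N (A *m B *m invmx A).

(* Simplicity of connected algebraic groups: proper closed normal subgroups may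
   be nontrivial as long as they are not connected (e.g. the center of SL_n). *)
Definition simple_algebraic_group G : Prop :=
  [/\ algebraic_group G,
      zariski_connected G,
      (exists A B, [/\ G A, G B & A *m B <> B *m A])
    & forall N, algebraic_group N -> zariski_connected N -> normal_in N G ->
        N = [set 1%:M] \/ N = G].

(* The Zariski tangent space at the identity. Functions regular on GL_n may have
   a power of \det as denominator, but since the latter is a unit at the identity
   polynomials vanishing on G define the same tangent space. *)
Definition lie_algebra G : set 'M[K]_n :=
  [set X | forall p : mpoly.mpoly (n * n)%N K,
    (forall A, G A -> mxpoly_eval A p = 0) -> mxpoly_diff 1%:M p X = 0].

Definition lie_bracket X Y : 'M[K]_n := X *m Y - Y *m X.

Definition lie_subalgebra (L : set 'M[K]_n) : Prop :=
  [/\ L 0,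
      forall X Y, L X -> L Y -> L (X + Y),
      forall (a : K) X, L X -> L (a *: X)
    & forall X Y, L X -> L Y -> L (lie_bracket X Y)].

Definition generated_lie_algebra (S : set 'M[K]_n) : set 'M[K]_n :=
  smallest lie_subalgebra S.

Definition nilpotent_mx X : Prop := exists k : nat, X ^+ k = 0.

End LinearAlgebraicGroups.

(* The limit is taken for the entrywise topology of matrices. *)
Definition expmx (K : numFieldType) (n : nat) (X : 'M[K]_n) : 'M[K]_n :=
  limn (series (fun k : nat => (k`!%:R : K)^-1 *: X ^+ k)).

(* Main.v *)
(* Let N be the Zariski closure of H in GL_n. It is a closed subgroup of G and
   contains the polynomial curves c |-> exp(cx) and c |-> exp(cy), because it
   contains them at the infinitely many points c = kt, resp. c = ks. Hence N is
   connected, x and y lie in Lie(N), and Lie(N) is stable under ad x and ad y,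
   so it contains Lie(G). For g in G, the nilpotent matrix g x g^-1 lies in
   Lie(G), hence in Lie(N), so g exp(cx) g^-1 = exp(c g x g^-1) lies in N: thus
   N is normal in G, and N = 1 or N = G by simplicity. If N = 1 then Lie(G) = 0,
   which makes 1 isolated in G; then the connected group G would be trivial. *)

Require Import Defs.
From mathcomp Require Import all_boot all_order all_algebra.
From mathcomp Require Import all_classical all_reals all_analysis.
From mathcomp Require Import complex.
From mathcomp Require mpoly.
From mathcomp Require Import ring.

Set Implicit Arguments.
Unset Strict Implicit.
Unset Printing Implicit Defensive.

Import Order.TTheory GRing.Theory Num.Theory.
Import numFieldNormedType.Exports.
Import (canonicals) mpoly.

Local Open Scope classical_set_scope.
Local Open Scope ring_scope.

(** * Polynomial functions of the entries of a matrix and their differentials *)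

(** Monomials are products of variables, so closure under products takes care of them. This form of
    induction suits the Leibniz rule and the composition of polynomials. *)
Lemma mpoly_ring_ind (R : nzRingType) (m : nat) (P : mpoly.mpoly m R -> Prop) :
    (forall c, P (mpoly.mpolyC m c)) ->
    (forall i, P (mpoly.mpolyX R (mpoly.mnm1 i))) ->
    (forall p q, P p -> P q -> P (p + q)) ->
    (forall p q, P p -> P q -> P (p * q)) ->
  forall p, P p.
Proof.
move=> PC PX PD PM; elim/mpoly.mpolyind => [|c u p _ _ Pp].
  by rewrite -(mpoly.mpolyC0 m R).
apply: PD => //; rewrite -mpoly.mul_mpolyC; apply: (PM) => //.
rewrite mpoly.mpolyXE_id; elim/big_ind: _ => [|p1 p2|i _].
- by rewrite -(mpoly.mpolyC1 m R).
- exact: PM.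
 elim: (mpoly.fun_of_multinom _ _) => [|k IH].
  by rewrite expr0 -(mpoly.mpolyC1 m R).
by rewrite exprS; exact: PM.
Qed.

Section PolynomialEvaluation.
Variables (K : fieldType) (n : nat).
Local Notation mp := (mpoly.mpoly (n * n)%N K).
Implicit Types (A X : 'M[K]_n) (p q : mp).

Definition mxpolyX (i j : 'I_n) : mp :=
  mpoly.mpolyX K (mpoly.mnm1 (mxvec_index i j)).

Lemma mxpoly_ind (P : mp -> Prop) :
    (forall c, P (mpoly.mpolyC _ c)) -> (forall i j, P (mxpolyX i j)) ->
    (forall p q, P p -> P q -> P (p + q)) ->
    (forall p q, P p -> P q -> P (p * q)) ->
  forall p, P p.
Proof.
by move=> PC PX PD PM; apply: mpoly_ring_ind => //; case/mxvec_indexP.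
Qed.

Lemma mxpoly_evalC A c : mxpoly_eval A (mpoly.mpolyC _ c) = c.
Proof. exact: mpoly.mevalC. Qed.

Lemma mxpoly_evalX A i j : mxpoly_eval A (mxpolyX i j) = A i j.
Proof. by rewrite /mxpoly_eval mpoly.mevalXU mxvecE. Qed.

Lemma mxpoly_evalD A p q :
  mxpoly_eval A (p + q) = mxpoly_eval A p + mxpoly_eval A q.
Proof. exact: mpoly.mevalD. Qed.

Lemma mxpoly_evalM A p q :
  mxpoly_eval A (p * q) = mxpoly_eval A p * mxpoly_eval A q.
Proof. exact: mpoly.mevalM. Qed.

Lemma mxpoly_diffC A X c : mxpoly_diff A (mpoly.mpolyC _ c) X = 0.
Proof.
rewrite /mxpoly_diff big1 // => k _.
by rewrite mpoly.mderivC /mxpoly_eval mpoly.meval0 mul0r.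
Qed.

Lemma mxpoly_diffD A X p q :
  mxpoly_diff A (p + q) X = mxpoly_diff A p X + mxpoly_diff A q X.
Proof.
rewrite /mxpoly_diff -big_split; apply: eq_bigr => k _ /=.
by rewrite mpoly.mderivD mxpoly_evalD mulrDl.
Qed.

Lemma mxpoly_diffM A X p q :
  mxpoly_diff A (p * q) X =
  mxpoly_diff A p X * mxpoly_eval A q + mxpoly_eval A p * mxpoly_diff A q X.
Proof.
rewrite /mxpoly_diff mulr_suml mulr_sumr -big_split; apply: eq_bigr => k _ /=.
rewrite mpoly.mderivM mxpoly_evalD !mxpoly_evalM; ring.
Qed.

Lemma mxpoly_eval_mderivX A k l :
  mxpoly_eval A (mpoly.mderiv k (mpoly.mpolyX K (mpoly.mnm1 l))) = (k == l)%:R.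
Proof.
rewrite /mxpoly_eval mpoly.mderivX mpoly.mnm1E eq_sym.
case: eqP => [->|_]; last by rewrite scale0r mpoly.meval0.
suff -> : mpoly.mnm_sub (mpoly.mnm1 l) (mpoly.mnm1 l) = mpoly.mnm0.
  by rewrite scale1r mpoly.mpolyX0 mpoly.meval1.
by apply/mpoly.mnmP => i; rewrite mpoly.mnmBE mpoly.mnm0E subnn.
Qed.

Lemma mxpoly_diffX A X i j : mxpoly_diff A (mxpolyX i j) X = X i j.
Proof.
rewrite /mxpoly_diff (bigD1 (mxvec_index i j)) //=.
rewrite big1 ?addr0 => [|k /negPf kn].
  by rewrite mxpoly_eval_mderivX eqxx mul1r mxvecE.
by rewrite mxpoly_eval_mderivX kn mul0r.
Qed.

Lemma mxpoly_diff_is_linear A p (a : K) X Y :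
  mxpoly_diff A p (a *: X + Y) = a * mxpoly_diff A p X + mxpoly_diff A p Y.
Proof.
rewrite /mxpoly_diff mulr_sumr -big_split; apply: eq_bigr => k _ /=.
by rewrite linearP !mxE; ring.
Qed.

(** Only the values matter, so that determinants and adjugates need no explicit expression in
    [mpoly]. *)
Definition polyfun (f : 'M[K]_n -> K) : Prop :=
  exists p, forall A, mxpoly_eval A p = f A.

Lemma polyfun_eval p : polyfun (fun A => mxpoly_eval A p).
Proof. by exists p. Qed.

Lemma polyfun_cst c : polyfun (fun=> c).
Proof. by exists (mpoly.mpolyC _ c) => A; rewrite mxpoly_evalC. Qed.

Lemma polyfun_entry i j : polyfun (fun A => A i j).
Proof. by exists (mxpolyX i j) => A; rewrite mxpoly_evalX. Qed.

Lemma polyfunM f g : polyfun f -> polyfun g -> polyfun (fun A => f A * g A).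
Proof.
by move=> [p pE] [q qE]; exists (p * q) => A; rewrite mxpoly_evalM pE qE.
Qed.

Lemma polyfun_sum (I : Type) (r : seq I) (F : I -> 'M[K]_n -> K) :
  (forall i, polyfun (F i)) -> polyfun (fun A => \sum_(i <- r) F i A).
Proof.
move=> pF; elim: r => [|i r [q qE]].
  by have [p pE] := polyfun_cst 0; exists p => A; rewrite pE big_nil.
have [p pE] := pF i; exists (p + q) => A.
by rewrite mxpoly_evalD pE qE big_cons.
Qed.

Lemma polyfun_prod (I : Type) (r : seq I) (F : I -> 'M[K]_n -> K) :
  (forall i, polyfun (F i)) -> polyfun (fun A => \prod_(i <- r) F i A).
Proof.
move=> pF; elim: r => [|i r [q qE]].
  by have [p pE] := polyfun_cst 1; exists p => A; rewrite pE big_nil.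
have [p pE] := pF i; exists (p * q) => A.
by rewrite mxpoly_evalM pE qE big_cons.
Qed.

Lemma polyfun_comp f (F : 'M[K]_n -> 'M[K]_n) :
  polyfun f -> (forall i j, polyfun (fun A => F A i j)) -> polyfun (f \o F).
Proof.
move=> [p pE] pF; suff [q qE] : exists q, forall A,
    mxpoly_eval A q = mxpoly_eval (F A) p by exists q => A; rewrite qE pE.
elim/mxpoly_ind: p {pE} => [c|i j|p1 p2 [q1 E1] [q2 E2]|p1 p2 [q1 E1] [q2 E2]].
- by exists (mpoly.mpolyC _ c) => A; rewrite !mxpoly_evalC.
- by have [q qE] := pF i j; exists q => A; rewrite qE mxpoly_evalX.
- by exists (q1 + q2) => A; rewrite !mxpoly_evalD E1 E2.
- by exists (q1 * q2) => A; rewrite !mxpoly_evalM E1 E2.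
Qed.

Lemma polyfun_mulmxl (B : 'M[K]_n) i j : polyfun (fun A => (B *m A) i j).
Proof.
have [p pE] : polyfun (fun A => \sum_k B i k * A k j).
  apply: polyfun_sum => k.
  by apply: polyfunM; [exact: polyfun_cst|exact: polyfun_entry].
by exists p => A; rewrite pE mxE.
Qed.

Lemma polyfun_mulmxr (B : 'M[K]_n) i j : polyfun (fun A => (A *m B) i j).
Proof.
have [p pE] : polyfun (fun A => \sum_k A i k * B k j).
  apply: polyfun_sum => k.
  by apply: polyfunM; [exact: polyfun_entry|exact: polyfun_cst].
by exists p => A; rewrite pE mxE.
Qed.

Lemma polyfun_det m (F : 'M[K]_n -> 'M[K]_m) :
  (forall i j, polyfun (fun A => F A i j)) -> polyfun (fun A => \det (F A)).
Proof.
(* [\det] unfolds to the Leibniz sum over permutations. *)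
move=> pF; apply: polyfun_sum => s.
by apply: polyfunM (polyfun_cst _) _; apply: polyfun_prod.
Qed.

Lemma polyfun_adj i j : polyfun (fun A => \adj A i j).
Proof.
have [p pE] : polyfun (fun A => cofactor A j i).
  apply: polyfunM (polyfun_cst _) _; apply: polyfun_det => k l.
  have [p pE] := polyfun_entry (lift j k) (lift i l).
  by exists p => A; rewrite pE !mxE.
by exists p => A; rewrite pE mxE.
Qed.

(** Cramer's rule: the inverse is the adjugate divided by the determinant, so a power of [\det A]
    clears all denominators. *)
Lemma mxpoly_eval_invmx p :
  exists q d, forall A, A \in unitmx ->
    mxpoly_eval A q = \det A ^+ d * mxpoly_eval (invmx A) p.
Proof.
have [D DE] : polyfun (fun A => \det A).
  by apply: polyfun_det => i j; apply: polyfun_entry.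
have eX q k A : mxpoly_eval A (q ^+ k) = mxpoly_eval A q ^+ k.
  elim: k => [|k IH].
    by rewrite !expr0 -[1]/(mpoly.mpolyC _ 1) mxpoly_evalC.
  by rewrite !exprS mxpoly_evalM IH.
elim/mxpoly_ind: p => [c|i j|p1 p2|p1 p2].
- by exists (mpoly.mpolyC _ c), 0%N => A _; rewrite !mxpoly_evalC mul1r.
- have [q qE] := polyfun_adj i j; exists q, 1%N => A uA.
  rewrite qE mxpoly_evalX expr1 /invmx uA [in RHS]mxE mulrA divff ?mul1r //.
  by rewrite -unitfE -unitmxE.
- move=> [q1 [d1 E1]] [q2 [d2 E2]]; exists (D ^+ d2 * q1 + D ^+ d1 * q2).
  exists (d1 + d2)%N => A uA.
  by rewrite !mxpoly_evalD !mxpoly_evalM !eX DE E1 // E2 // exprD; ring.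
- move=> [q1 [d1 E1]] [q2 [d2 E2]]; exists (q1 * q2), (d1 + d2)%N => A uA.
  by rewrite !mxpoly_evalM E1 // E2 // exprD; ring.
Qed.

(** Hadamard's lemma: the quotients [M k] are again polynomials, and their values at [A0] represent
    the differential of p. At the identity they supply the matrix of the Nakayama argument. *)
Lemma mxpoly_taylor1 A0 p :
  exists M : 'I_(n * n) -> mp,
    (forall A, mxpoly_eval A p =
      mxpoly_eval A0 p +
      \sum_k mxpoly_eval A (M k) * mxvec (A - A0) ord0 k) /\
    (forall X, mxpoly_diff A0 p X =
      \sum_k mxpoly_eval A0 (M k) * mxvec X ord0 k).
Proof.
elim/mxpoly_ind: p => [c|i j|p1 p2|p1 p2].
- exists (fun=> mpoly.mpolyC _ 0); split=> A.
    by rewrite !mxpoly_evalC big1 ?addr0 // => k _; rewrite mul0r.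
  by rewrite mxpoly_diffC big1 // => k _; rewrite mxpoly_evalC mul0r.
- exists (fun k => mpoly.mpolyC _ (k == mxvec_index i j)%:R).
  have sumE A X : \sum_k mxpoly_eval A (mpoly.mpolyC (n * n)
      (k == mxvec_index i j)%:R) * mxvec X ord0 k = X i j.
    rewrite (bigD1 (mxvec_index i j)) //= eqxx mxpoly_evalC mul1r mxvecE.
    by rewrite big1 ?addr0 // => k /negPf->; rewrite mxpoly_evalC mul0r.
  by split=> A; rewrite sumE ?mxpoly_diffX // !mxpoly_evalX !mxE; ring.
- move=> [M1 [E1 D1]] [M2 [E2 D2]]; exists (fun k => M1 k + M2 k); split=> A.
    rewrite !mxpoly_evalD E1 E2 addrACA -big_split; congr (_ + _).
    by apply: eq_bigr => k _ /=; rewrite mxpoly_evalD mulrDl.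
  rewrite mxpoly_diffD D1 D2 -big_split.
  by apply: eq_bigr => k _ /=; rewrite mxpoly_evalD mulrDl.
- move=> [M1 [E1 D1]] [M2 [E2 D2]].
  (* From p1 p2 - p1(A0) p2(A0) = p1 (p2 - p2(A0)) + (p1 - p1(A0)) p2(A0). *)
  exists (fun k => p1 * M2 k + M1 k * mpoly.mpolyC _ (mxpoly_eval A0 p2)).
  split=> A.
    rewrite !mxpoly_evalM E2 mulrDr {1}E1 mulrDl -addrA; congr (_ + _).
    rewrite mulr_suml mulr_sumr addrC -big_split; apply: eq_bigr => k _ /=.
    rewrite mxpoly_evalD !mxpoly_evalM mxpoly_evalC; ring.
  rewrite mxpoly_diffM D1 D2 mulr_suml mulr_sumr addrC -big_split.
  apply: eq_bigr => k _ /=.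
  rewrite mxpoly_evalD !mxpoly_evalM mxpoly_evalC; ring.
Qed.

Definition mxeval (F : 'M[{poly K}]_n) (c : K) : 'M[K]_n :=
  map_mx (fun f => f.[c]) F.

(** The chain rule, by the Leibniz rule on products. It reduces questions about polynomials
    vanishing on a group to one-variable polynomials. *)
Lemma mxpoly_curve p (F : 'M[{poly K}]_n) :
  exists P : {poly K}, forall c,
    P.[c] = mxpoly_eval (mxeval F c) p /\
    P^`().[c] = mxpoly_diff (mxeval F c) p (mxeval (map_mx (@deriv K) F) c).
Proof.
elim/mxpoly_ind: p => [a|i j|p1 p2 [P1 E1] [P2 E2]|p1 p2 [P1 E1] [P2 E2]].
- by exists a%:P => c; rewrite derivC !hornerE mxpoly_evalC mxpoly_diffC.
- by exists (F i j) => c; rewrite mxpoly_evalX mxpoly_diffX !mxE.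
- exists (P1 + P2) => c; have [? ?] := E1 c; have [? ?] := E2 c.
  by rewrite derivD !hornerE mxpoly_evalD mxpoly_diffD; split; congr (_ + _).
- exists (P1 * P2) => c; have [e1 d1] := E1 c; have [e2 d2] := E2 c.
  by rewrite derivM !hornerE mxpoly_evalM mxpoly_diffM e1 d1 e2 d2.
Qed.

End PolynomialEvaluation.

(** * Zariski closure, in the space of matrices and in GL_n *)

Section ZariskiHull.
Variables (K : closedFieldType) (n : nat).
Local Notation mp := (mpoly.mpoly (n * n)%N K).
Implicit Types (S T H G : set 'M[K]_n) (A B X : 'M[K]_n) (p q : mp).

Definition vanishes_on S p : Prop := forall A, S A -> mxpoly_eval A p = 0.

(** The zero locus of the ideal of S: a form of the Zariski closure that exposes the equations. *)
Definition zariski_hull S : set 'M[K]_n :=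
  [set A | forall p, vanishes_on S p -> mxpoly_eval A p = 0].

Definition gl_closure S : set 'M[K]_n :=
  zariski_hull S `&` [set A | A \in unitmx].

Lemma zariski_closedP (F : set (zariski_mx K n)) :
  closed F <-> exists S : set mp,
    F = [set A | forall p, S p -> mxpoly_eval A p = 0].
Proof.
split=> [/closed_openC [S]|[S FE]].
  by rewrite setCK => FE; exists S.
rewrite -[F]setCK; apply: open_closedC.
by exists S; rewrite setCK.
Qed.

Lemma zariski_openP (U : set (zariski_mx K n)) :
  open U <-> exists S : set mp,
    ~` U = [set A | forall p, S p -> mxpoly_eval A p = 0].
Proof. by []. Qed.

Lemma sub_zariski_hull S : S `<=` zariski_hull S.
Proof. by move=> A SA p; apply. Qed.

Lemma zariski_hull_sub_closed S (F : set (zariski_mx K n)) :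
  closed F -> S `<=` F -> zariski_hull S `<=` F.
Proof.
move=> /zariski_closedP [T ->] ST A SA p Tp.
by apply: SA => B /ST; apply.
Qed.

Lemma zariski_hull_closed S : @closed (zariski_mx K n) (zariski_hull S).
Proof. by apply/zariski_closedP; exists (vanishes_on S). Qed.

Lemma zariski_hull_sub_closure S :
  zariski_hull S `<=` @closure (zariski_mx K n) S.
Proof.
apply: zariski_hull_sub_closed; first exact: closed_closure.
exact: (@subset_closure (zariski_mx K n)).
Qed.

(** Polynomial maps are continuous: composition with f pulls an equation of T back to an equation of
    S. *)
Lemma zariski_hull_map S T (f : 'M[K]_n -> 'M[K]_n) :
    (forall i j, polyfun (fun A => f A i j)) ->
    (forall A, S A -> zariski_hull T (f A)) ->
  forall A, zariski_hull S A -> zariski_hull T (f A).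
Proof.
move=> pf fST A SA p Tp; have [q qE] := polyfun_comp (polyfun_eval p) pf.
by rewrite -[LHS]qE; apply: SA => B SB; rewrite qE; apply: fST.
Qed.

Lemma sub_gl_closure H : gl_subgroup H -> H `<=` gl_closure H.
Proof.
by case=> uH _ _ _ A HA; split; [exact: sub_zariski_hull | exact: uH].
Qed.

Lemma gl_subgroup_closure H : gl_subgroup H -> gl_subgroup (gl_closure H).
Proof.
move=> gH; have [uH H1 HM HV] := gH.
split=> [A [] //||A B [hA uA] [hB uB]|A [hA uA]].
- exact: sub_gl_closure.
- split; last by rewrite /= unitmx_mul uA.
  (* Right multiplication by B is continuous, so A may be replaced by some C in H; left
     multiplication by C then allows B to be taken in H too. *)
  move: hA; apply: (zariski_hull_map (f := fun A => A *m B)).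
    by move=> i j; apply: polyfun_mulmxr.
  move=> C HC; move: hB; apply: (zariski_hull_map (f := fun B => C *m B)).
    by move=> i j; apply: polyfun_mulmxl.
  by move=> D HD; apply: sub_zariski_hull; apply: HM.
- split; last by rewrite /= unitmx_inv.
  (* Inversion is not polynomial: the equation of H to use is p(A^-1) multiplied by a power of the
     determinant, which is nonzero at A. *)
  move=> p Hp; have [q [d qE]] := mxpoly_eval_invmx p.
  have /eqP : mxpoly_eval A q = 0.
    by apply: hA => B HB; rewrite qE ?uH // Hp ?mulr0 //; apply: HV.
  rewrite qE // mulf_eq0 expf_eq0 => /orP[/andP[_ d0]|/eqP//].
  by move: uA; rewrite /= unitmxE unitfE d0.
Qed.

Lemma algebraic_group_closure H :
  gl_subgroup H -> algebraic_group (gl_closure H).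
Proof.
move=> gH; split; first exact: gl_subgroup_closure.
by exists (zariski_hull H) => //; apply: zariski_hull_closed.
Qed.

Lemma gl_closure_sub G S : algebraic_group G -> S `<=` G -> gl_closure S `<=` G.
Proof.
move=> [_ [F clF GE]] SG A [hA uA]; rewrite GE; split=> //.
by apply: (zariski_hull_sub_closed clF) hA => B /SG; rewrite GE => -[].
Qed.

End ZariskiHull.

(** * Polynomial curves of matrices and tangent spaces *)

Section MatrixCurves.
Variables (K : numClosedFieldType) (n : nat).
Local Notation mp := (mpoly.mpoly (n * n)%N K).
Implicit Types (S H G : set 'M[K]_n) (A B X Y : 'M[K]_n) (p q : mp).
Implicit Types (F : 'M[{poly K}]_n).

(** In characteristic 0 the multiples of t are distinct, so a nonzero P would have [size P] roots,
    one more than its degree. *)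
Lemma poly_eq0_progression (P : {poly K}) (t : K) :
  t != 0 -> (forall k : nat, P.[k%:R * t] = 0) -> P = 0.
Proof.
move=> t0 P0; apply/eqP/negPn/negP => Pn0.
have := max_poly_roots Pn0 (rs := [seq k%:R * t | k <- iota 0 (size P)]).
rewrite size_map size_iota ltnn => Pr; suff : false by [].
apply: Pr.
  by apply/allP => _ /mapP[k _ ->]; apply/rootP.
rewrite map_inj_in_uniq ?iota_uniq // => i j _ _ /(mulIf t0) /eqP.
by rewrite eqr_nat => /eqP.
Qed.

Lemma poly_eq0_horner (P : {poly K}) : (forall c, P.[c] = 0) -> P = 0.
Proof.
by move=> P0; apply: (@poly_eq0_progression P 1) => [|k]; rewrite ?oner_eq0.
Qed.

Lemma mxevalM F1 F2 c : mxeval (F1 *m F2) c = mxeval F1 c *m mxeval F2 c.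
Proof. exact: (map_mxM (horner_eval c)). Qed.

Lemma map_deriv_mulmx F1 F2 :
  map_mx (@deriv K) (F1 *m F2) =
  map_mx (@deriv K) F1 *m F2 + F1 *m map_mx (@deriv K) F2.
Proof.
apply/matrixP => i j; rewrite !mxE raddf_sum -big_split.
apply: eq_bigr => k _ /=.
by rewrite derivM !mxE.
Qed.

Lemma mxeval_const A c : mxeval (map_mx polyC A) c = A.
Proof. by apply/matrixP => i j; rewrite !mxE hornerC. Qed.

Lemma map_deriv_const A : map_mx (@deriv K) (map_mx polyC A) = 0.
Proof. by apply/matrixP => i j; rewrite !mxE derivC. Qed.

(** An equation of S restricts to a one-variable polynomial with infinitely many roots. This passes
    from the powers of one element to a whole one-parameter group. *)
Lemma curve_in_hull S F (t : K) : t != 0 ->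
    (forall k : nat, S (mxeval F (k%:R * t))) ->
  forall c, zariski_hull S (mxeval F c).
Proof.
move=> t0 SF c p Sp; have [P PE] := mxpoly_curve p F.
suff P0 : P = 0 by have [<- _] := PE c; rewrite P0 horner0.
apply: (poly_eq0_progression t0) => k.
by have [-> _] := PE (k%:R * t); apply: Sp.
Qed.

Lemma curve_tangent S F :
    (forall c, S (mxeval F c)) -> mxeval F 0 = 1%:M ->
  lie_algebra S (mxeval (map_mx (@deriv K) F) 0).
Proof.
move=> SF F0 p Sp; have [P PE] := mxpoly_curve p F.
have P0 : P = 0 by apply: poly_eq0_horner => c; have [-> _] := PE c; apply: Sp.
by have [_] := PE 0; rewrite F0 => <-; rewrite P0 deriv0 horner0.
Qed.

Definition mxline A X : 'M[{poly K}]_n :=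
  \matrix_(i, j) ((A i j)%:P + (X i j)%:P * 'X).

Lemma mxeval_line A X c : mxeval (mxline A X) c = A + c *: X.
Proof. by apply/matrixP => i j; rewrite !mxE !hornerE mulrC. Qed.

Lemma mxeval_deriv_line A X c :
  mxeval (map_mx (@deriv K) (mxline A X)) c = X.
Proof.
by apply/matrixP => i j; rewrite !mxE derivD derivC deriv_mulC derivX !hornerE.
Qed.

(** The chain rule for A |-> B A C, read off at 0 on the line A + cX and on its image. *)
Lemma mxpoly_diff_translate p q B C :
    (forall A, mxpoly_eval A q = mxpoly_eval (B *m A *m C) p) ->
  forall A X, mxpoly_diff A q X = mxpoly_diff (B *m A *m C) p (B *m X *m C).
Proof.
move=> qp A X.
have [P PE] := mxpoly_curve p (mxline (B *m A *m C) (B *m X *m C)).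
have [Q QE] := mxpoly_curve q (mxline A X).
have PQ : Q = P.
  apply/eqP; rewrite -subr_eq0; apply/eqP/poly_eq0_horner => c.
  rewrite hornerD hornerN; have [-> _] := PE c; have [-> _] := QE c.
  rewrite !mxeval_line qp mulmxDr mulmxDl -scalemxAr -scalemxAl subrr //.
have [_] := PE 0; have [_] := QE 0.
by rewrite !mxeval_deriv_line !mxeval_line !scale0r !addr0 PQ => <-.
Qed.

(** With C = 1 this moves tangent vectors from the identity to B; with C = B^-1 it gives the adjoint
    action. *)
Lemma vanishes_on_translate S p B C :
    (forall A, S A -> S (B *m A *m C)) -> vanishes_on S p ->
  exists2 q, vanishes_on S q &
    forall A X, mxpoly_diff A q X = mxpoly_diff (B *m A *m C) p (B *m X *m C).
Proof.
move=> SS Sp.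
have [|q qE] := polyfun_comp (F := fun A => B *m A *m C) (polyfun_eval p).
  move=> i j.
  have [q qE] := polyfun_comp (polyfun_mulmxr C i j) (polyfun_mulmxl B).
  by exists q => A; rewrite qE.
exists q => [A SA|]; first by rewrite qE; apply/Sp/SS.
exact: mxpoly_diff_translate.
Qed.

Lemma mxpoly_diff_left G p X : gl_subgroup G -> lie_algebra G X ->
  vanishes_on G p -> forall A, G A -> mxpoly_diff A p (A *m X) = 0.
Proof.
move=> [uG G1 GM _] LX Gp A GA.
have [|q Gq qE] := vanishes_on_translate (B := A) (C := 1%:M) _ Gp.
  by move=> B GB; rewrite mulmx1; apply: GM.
by have := LX q Gq; rewrite qE !mulmx1.
Qed.

Lemma lie_algebra_conj G A X : gl_subgroup G -> G A -> lie_algebra G X ->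
  lie_algebra G (A *m X *m invmx A).
Proof.
move=> [uG G1 GM GV] GA LX p Gp.
have [|q Gq qE] := vanishes_on_translate (B := A) (C := invmx A) _ Gp.
  by move=> B GB; apply: (GM); [exact: GM | exact: GV].
by have := LX q Gq; rewrite qE mulmx1 mulmxV // uG.
Qed.

Lemma lie_algebra_linear G (a : K) X Y :
  lie_algebra G X -> lie_algebra G Y -> lie_algebra G (a *: X + Y).
Proof.
by move=> LX LY p Gp; rewrite mxpoly_diff_is_linear LX // LY // mulr0 addr0.
Qed.

Lemma lie_algebra0 G : lie_algebra G 0.
Proof.
by move=> p _; rewrite /mxpoly_diff big1 // => k _; rewrite linear0 mxE mulr0.
Qed.

(** Lie(G) is cut out by linear equations. Along F each becomes a one-variable polynomial that
    vanishes everywhere, and so does its derivative. *)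
Lemma lie_algebra_curve_deriv G F :
    (forall c, lie_algebra G (mxeval F c)) ->
  forall c, lie_algebra G (mxeval (map_mx (@deriv K) F) c).
Proof.
move=> LF c p Gp.
pose P : {poly K} := \sum_k
  (mxpoly_eval 1%:M (mpoly.mderiv k p))%:P * mxvec F ord0 k.
have P0 : P = 0.
  apply: poly_eq0_horner => d; rewrite -[RHS](LF d p Gp) horner_sum.
  apply: eq_bigr => k _; rewrite hornerM hornerC.
  by case/mxvec_indexP: k => i j; rewrite !mxvecE mxE.
rewrite -[RHS](horner0 c) -[in RHS](deriv0 K) -P0 raddf_sum horner_sum.
apply: eq_bigr => k _ /=; rewrite deriv_mulC hornerM hornerC.
by case/mxvec_indexP: k => i j; rewrite !mxvecE !mxE.
Qed.

End MatrixCurves.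

(** * Exponentials of nilpotent matrices as polynomial curves *)

Section TruncatedExponential.
Variables (K : numClosedFieldType) (n : nat).
Implicit Types (S H G : set 'M[K]_n) (A B X Y : 'M[K]_n).

Lemma exprZmx c X k : (c *: X) ^+ k = c ^+ k *: X ^+ k.
Proof.
elim: k => [|k IH]; first by rewrite !expr0 scale1r.
by rewrite !exprS IH -!mulmxE -scalemxAl -scalemxAr scalerA.
Qed.

(** The exponential of X as soon as X^m = 0, written as a finite sum so that c |-> exp(cX) is a
    polynomial curve. *)
Definition texp (m : nat) X : 'M[K]_n := \sum_(k < m) (k`!%:R)^-1 *: X ^+ k.

Definition texp_curve (m : nat) X : 'M[{poly K}]_n :=
  \matrix_(i, j) \sum_(k < m) ((k`!%:R)^-1 * (X ^+ k) i j)%:P * 'X^k.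

Lemma mxeval_texp m X c : mxeval (texp_curve m X) c = texp m (c *: X).
Proof.
apply/matrixP => i j; rewrite !mxE horner_sum summxE; apply: eq_bigr => k _.
by rewrite !hornerE !mxE exprZmx mxE; ring.
Qed.

Lemma mxeval_deriv_texp m X c : X ^+ m = 0 ->
  mxeval (map_mx (@deriv K) (texp_curve m X)) c = texp m (c *: X) *m X.
Proof.
case: m => [|m] Xm.
  (* For m = 0 the hypothesis reads 1 = 0, so all matrices are equal. *)
  have M0 A : A = 0 by rewrite -[A]mul1r -[1](expr0 X) Xm mul0r.
  by rewrite [LHS]M0 [RHS]M0.
(* The top term dies because X^(m+1) = 0, while differentiation kills the constant term; the
   remaining terms correspond with a shift by one. *)
have -> : texp m.+1 (c *: X) *m X =
    \sum_(k < m) ((k`!%:R)^-1 * c ^+ k) *: X ^+ k.+1.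
  rewrite /texp big_ord_recr /= mulmxDl mulmx_suml exprZmx -!scalemxAl.
  rewrite -[X ^+ m *m X]/(X ^+ m * X) -exprSr Xm !scaler0 addr0.
  by apply: eq_bigr => k _; rewrite exprZmx scalerA -scalemxAl mulmxE -exprSr.
apply/matrixP => i j; rewrite !mxE summxE raddf_sum horner_sum big_ord_recl /=.
rewrite expr0 mulr1 derivC horner0 add0r; apply: eq_bigr => k _.
rewrite deriv_mulC derivXn !hornerE hornerMn hornerXn mxE /= /bump /= add1n.
have k0 : (k.+1%:R : K) != 0 by rewrite pnatr_eq0.
have kf : (k`!%:R : K) != 0 by rewrite pnatr_eq0 -lt0n fact_gt0.
by rewrite factS natrM -mulr_natr; field; rewrite kf addrC natr1.
Qed.

(** The index [m.+1] guarantees a constant term: the empty sum would give 0. *)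
Lemma texp0 m : texp m.+1 0 = 1%:M.
Proof.
rewrite /texp big_ord_recl /= big1 ?addr0 => [|k _].
  by rewrite expr0 fact0 invr1 scale1r.
by rewrite expr0n scaler0.
Qed.

Lemma texpD m X a b : X ^+ m = 0 ->
  texp m (a *: X) *m texp m (b *: X) = texp m ((a + b) *: X).
Proof.
(* [ev] evaluates at X, ignoring degrees at least m, where powers of X vanish; [e a] is the
   truncated series of exp(aT). The identity then follows by comparing coefficients below m with the
   binomial formula. *)
move=> Xm; pose ev (P : {poly K}) := \sum_(k < m) P`_k *: X ^+ k.
pose e (a : K) : {poly K} := \poly_(k < m) ((k`!%:R)^-1 * a ^+ k).
have evXn k : ev 'X^k = X ^+ k.
  rewrite /ev; case: (ltnP k m) => [km|mk].
    rewrite (bigD1 (Ordinal km)) //= coefXn eqxx scale1r big1 ?addr0 // => i.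
    by rewrite -val_eqE /= coefXn => /negPf->; rewrite scale0r.
  have -> : X ^+ k = 0 by rewrite -(subnK mk) exprD Xm mulr0.
  rewrite big1 // => i _; rewrite coefXn ltn_eqF ?scale0r //.
  exact: leq_trans (ltn_ord i) mk.
have evD P Q : ev (P + Q) = ev P + ev Q.
  by rewrite /ev -big_split; apply: eq_bigr => k _ /=; rewrite coefD scalerDl.
have evZ d P : ev (d *: P) = d *: ev P.
  by rewrite /ev scaler_sumr; apply: eq_bigr => k _; rewrite coefZ scalerA.
have ev0 : ev 0 = 0 by rewrite -[0 : {poly K}](scale0r 0) evZ scale0r.
have evE P d : P = e d -> ev P = texp m (d *: X).
  move=> ->; apply: eq_bigr => k _.
  by rewrite coef_poly ltn_ord exprZmx scalerA.
have -> : texp m (a *: X) *m texp m (b *: X) = ev (e a * e b).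
  rewrite /e !poly_def mulr_suml (big_morph ev evD ev0) /texp mulmx_suml.
  apply: eq_bigr => i _; rewrite mulr_sumr (big_morph ev evD ev0) mulmx_sumr.
  apply: eq_bigr => j _; rewrite -scalerAl -scalerAr -exprD !evZ evXn.
  rewrite !exprZmx -!scalemxAl -!scalemxAr !scalerA exprD mulmxE.
  by congr (_ *: _); ring.
apply: eq_bigr => k _; rewrite coefM exprZmx scalerA; congr (_ *: _).
rewrite addrC exprDn mulr_sumr; apply: eq_bigr => i _.
have ik : (i <= k)%N by rewrite -ltnS.
rewrite !coef_poly (leq_ltn_trans ik) // (leq_ltn_trans (leq_subr _ _)) //.
have nf l : (l`!%:R : K) != 0 by rewrite pnatr_eq0 -lt0n fact_gt0.
rewrite -(bin_fact ik) !natrM -mulr_natr.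
have bn : ('C(k, i)%:R : K) != 0 by rewrite pnatr_eq0 -lt0n bin_gt0.
by field; rewrite bn !nf.
Qed.

Lemma texp_unit m X a : X ^+ m.+1 = 0 ->
  texp m.+1 (a *: X) *m texp m.+1 (- a *: X) = 1%:M.
Proof. by move=> Xm; rewrite texpD // subrr scale0r texp0. Qed.

Lemma texp_unitmx m X a : X ^+ m.+1 = 0 -> texp m.+1 (a *: X) \in unitmx.
Proof. by move=> Xm; have /mulmx1_unit[] := texp_unit a Xm. Qed.

Lemma texp_natmul m X a k : X ^+ m.+1 = 0 ->
  texp m.+1 ((k%:R * a) *: X) = (texp m.+1 (a *: X)) ^+ k.
Proof.
move=> Xm; elim: k => [|k IH]; first by rewrite mul0r scale0r texp0 expr0.
by rewrite exprS -IH -mulmxE texpD // -{2}[a]mul1r -mulrDl -natr1 addrC.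
Qed.

Lemma texp_conj m X A a : A \in unitmx ->
  A *m texp m (a *: X) *m invmx A = texp m (a *: (A *m X *m invmx A)).
Proof.
move=> uA; have conjX k : A *m X ^+ k *m invmx A = (A *m X *m invmx A) ^+ k.
  elim: k => [|k IH]; first by rewrite !expr0 mulmx1 mulmxV.
  by rewrite !exprS -IH -!mulmxE !mulmxA mulmxKV.
rewrite /texp mulmx_sumr mulmx_suml; apply: eq_bigr => k _.
by rewrite !exprZmx -!scalemxAr -!scalemxAl conjX.
Qed.

Lemma nilpotent_conj m X A : A \in unitmx -> X ^+ m = 0 ->
  (A *m X *m invmx A) ^+ m = 0.
Proof.
move=> uA Xm; suff -> : (A *m X *m invmx A) ^+ m = A *m X ^+ m *m invmx A.
  by rewrite Xm mulmx0 mul0mx.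
elim: m {Xm} => [|k IH]; first by rewrite !expr0 mulmx1 mulmxV.
by rewrite !exprS IH -!mulmxE !mulmxA mulmxKV.
Qed.

(* The left-invariant vector field of X preserves the ideal of G, so all Taylor
   coefficients at 0 of c |-> p(exp(cX)) vanish. *)
Lemma texp_lie_algebra G m X c : algebraic_group G -> lie_algebra G X ->
  X ^+ m.+1 = 0 -> G (texp m.+1 (c *: X)).
Proof.
move=> aG LX Xm; have gG := aG.1; have [_ G1 _ _] := gG.
apply: (gl_closure_sub (S := G) aG) => //; split; last exact: texp_unitmx.
pose E := texp_curve m.+1 X.
have P_coef0 j : forall p (P : {poly K}), vanishes_on G p ->
    (forall d, P.[d] = mxpoly_eval (mxeval E d) p) -> P`_j = 0.
  elim: j => [|j IH] p P Gp PE.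
    by rewrite -horner_coef0 PE mxeval_texp scale0r texp0 Gp.
  (* The derivative of p along the field A |-> A X. On the curve it restricts to P', whose
     coefficient j is j+1 times the coefficient j+1 of P. *)
  have [q qE] : polyfun (fun A => mxpoly_diff A p (A *m X)).
    apply: polyfun_sum => k; apply: polyfunM; first exact: polyfun_eval.
    case/mxvec_indexP: k => i l; have [q qE] := polyfun_mulmxr X i l.
    by exists q => A; rewrite qE mxvecE.
  have [P1 P1E] := mxpoly_curve p E.
  have PP1 : P = P1.
    apply/eqP; rewrite -subr_eq0; apply/eqP/poly_eq0_horner => d.
    by rewrite hornerD hornerN PE; have [-> _] := P1E d; rewrite subrr.
  have /eqP : P^`()`_j = 0.
    apply: (IH q) => [A GA|d]; first by rewrite qE (mxpoly_diff_left gG).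
    rewrite qE PP1; have [_ ->] := P1E d.
    by rewrite mxeval_deriv_texp // mxeval_texp.
  by rewrite coef_deriv mulrn_eq0 => /eqP.
move=> p Gp; have [P PE] := mxpoly_curve p E.
suff P0 : P = 0.
  by rewrite -mxeval_texp; have [<- _] := PE c; rewrite P0 horner0.
apply/polyP => j; rewrite coef0.
by apply: (P_coef0 j p) => // d; have [-> _] := PE d.
Qed.

Lemma gl_subgroupX H A k : gl_subgroup H -> H A -> H (A ^+ k).
Proof.
move=> [_ H1 HM _] HA; elim: k => [|k IH]; first by rewrite expr0.
by rewrite exprS -mulmxE; apply: HM.
Qed.

(** The powers of exp(tX) lie in H and are the points of the curve at the multiples of t. *)
Lemma texp_gl_closure H m X t c : gl_subgroup H -> X ^+ m.+1 = 0 -> t != 0 ->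
  H (texp m.+1 (t *: X)) -> gl_closure H (texp m.+1 (c *: X)).
Proof.
move=> gH Xm t0 HX; split; last exact: texp_unitmx.
rewrite -mxeval_texp; apply: (curve_in_hull t0) => k.
by rewrite mxeval_texp texp_natmul //; apply: gl_subgroupX.
Qed.

Lemma texp_tangent G m X : X ^+ m.+1 = 0 ->
  (forall c, G (texp m.+1 (c *: X))) -> lie_algebra G X.
Proof.
move=> Xm GX.
have := @curve_tangent K n G (texp_curve m.+1 X).
rewrite mxeval_deriv_texp // mxeval_texp scale0r texp0 mul1mx; apply => // c.
by rewrite mxeval_texp.
Qed.

(* Derivative at 0 of c |-> exp(cX) Z exp(-cX). *)
Lemma lie_algebra_ad G m X Z : gl_subgroup G -> X ^+ m.+1 = 0 ->
  (forall c, G (texp m.+1 (c *: X))) -> lie_algebra G Z ->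
  lie_algebra G (lie_bracket X Z).
Proof.
move=> gG Xm GX LZ; have [uG _ _ _] := gG.
have NXm : (- X) ^+ m.+1 = 0 by rewrite exprNn Xm mulr0.
pose F := texp_curve m.+1 X *m map_mx polyC Z *m texp_curve m.+1 (- X).
have LF c : lie_algebra G (mxeval F c).
  rewrite /F !mxevalM mxeval_const !mxeval_texp.
  have -> : texp m.+1 (c *: - X) = invmx (texp m.+1 (c *: X)).
    rewrite -[RHS]mulmx1 -(texp_unit c Xm) mulmxA mulVmx ?texp_unitmx //.
    by rewrite mul1mx scalerN scaleNr.
  exact: lie_algebra_conj.
have := lie_algebra_curve_deriv LF 0.
have mxevalD (A B : 'M[{poly K}]_n) :
    mxeval (A + B) 0 = mxeval A 0 + mxeval B 0.
  by apply/matrixP => i j; rewrite !mxE hornerD.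
rewrite /F !map_deriv_mulmx map_deriv_const mulmx0 addr0 mxevalD !mxevalM.
rewrite !mxeval_deriv_texp // !mxeval_texp mxeval_const !scale0r texp0.
by rewrite !mul1mx mulmx1 mulmxN.
Qed.

End TruncatedExponential.

(** * Generated subgroups and generated Lie algebras *)

Section ClosedSubgroups.
Variables (K : numClosedFieldType) (n : nat).
Local Notation mp := (mpoly.mpoly (n * n)%N K).
Implicit Types (S H G N : set 'M[K]_n) (A B X Y : 'M[K]_n) (p q : mp).

Lemma sub_generated_subgroup S : S `<=` generated_subgroup S.
Proof. by move=> A SA T [_]; apply. Qed.

Lemma generated_subgroup_sub S G :
  gl_subgroup G -> S `<=` G -> generated_subgroup S `<=` G.
Proof. by move=> gG SG A; apply. Qed.

Lemma gl_subgroup_generated S G :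
  gl_subgroup G -> S `<=` G -> gl_subgroup (generated_subgroup S).
Proof.
move=> gG SG; split=> [A gA||A B gA gB|A gA].
- by have [uG _ _ _] := gG; apply: uG; apply: gA.
- by move=> T [[_ T1 _ _] _].
- by move=> T [[uT T1 TM TV] ST]; apply: (TM); [exact: gA | exact: gB].
- by move=> T [[uT T1 TM TV] ST]; apply: (TV); exact: gA.
Qed.

Lemma generated_lie_algebra_sub G m (x y : 'M[K]_n) : gl_subgroup G ->
    x ^+ m.+1 = 0 -> (forall c, G (texp m.+1 (c *: x))) ->
    y ^+ m.+1 = 0 -> (forall c, G (texp m.+1 (c *: y))) ->
  generated_lie_algebra [set x; y] `<=` lie_algebra G.
Proof.
move=> gG xm Gx ym Gy Z gZ.
(* The elements Z of Lie(G) with [Z, Lie(G)] in Lie(G) form a Lie subalgebra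
   by the Jacobi identity, whether or not Lie(G) is known to be one. *)
suff [] : lie_algebra G Z /\
  forall W, lie_algebra G W -> lie_algebra G (lie_bracket Z W) by [].
apply: (gZ [set Z | lie_algebra G Z /\
  forall W, lie_algebra G W -> lie_algebra G (lie_bracket Z W)]).
split; last first.
  by move=> _ /= [->|->]; split; try exact: (@texp_tangent K n G m);
    move=> W; apply: (@lie_algebra_ad K n G m).
have LZ a X : lie_algebra G X -> lie_algebra G (a *: X).
  move=> LX; rewrite -[_ *: _]addr0.
  by apply: lie_algebra_linear => //; apply: lie_algebra0.
have LD X Y : lie_algebra G X -> lie_algebra G Y -> lie_algebra G (X + Y).
  by move=> LX LY; rewrite -[X]scale1r; apply: lie_algebra_linear.
split=> [|X Y [LX nX] [LY nY]|a X [LX nX]|X Y [LX nX] [LY nY]]; split.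
- exact: lie_algebra0.
- by move=> W _; rewrite /lie_bracket mul0mx mulmx0 subrr; apply: lie_algebra0.
- exact: LD.
- move=> W LW; rewrite /lie_bracket mulmxDl mulmxDr opprD addrACA.
  by apply: LD; [apply: nX | apply: nY].
- exact: LZ.
- move=> W LW; rewrite /lie_bracket -scalemxAl -scalemxAr -scalerBr.
  by apply: LZ; apply: nX.
- exact: nX.
- move=> W LW.
  have -> : lie_bracket (lie_bracket X Y) W =
    lie_bracket X (lie_bracket Y W) + -1 *: lie_bracket Y (lie_bracket X W).
    rewrite scaleN1r /lie_bracket !mulmxBl !mulmxBr !mulmxA.
    by apply/matrixP => i j; rewrite !mxE; ring.
  by apply: LD; [apply/nX/nY | apply/LZ/nY/nX].
Qed.

(** * Connectedness and normality of the closure of a generated subgroup *)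

(** The affine line is connected: an equation of B and one of its complement in N have product zero
    along the curve, and [{poly K}] is an integral domain. *)
Lemma curve_clopen N (B : set 'M[K]_n) (F : 'M[{poly K}]_n) :
    (exists2 U : set (zariski_mx K n), open U & B = N `&` U) ->
    (exists2 C : set (zariski_mx K n), closed C & B = N `&` C) ->
    (forall c, N (mxeval F c)) ->
  forall a b, B (mxeval F a) -> B (mxeval F b).
Proof.
move=> [U /zariski_openP [T UT] BU] [C /zariski_closedP [S CS] BC] NF a b Ba.
apply: contrapT => nBb.
have /existsNP [p /not_implyP [Sp pb]] :
    ~ forall p, S p -> mxpoly_eval (mxeval F b) p = 0.
  by move=> Cb; apply: nBb; rewrite BC CS; split; [apply: NF | apply: Cb].
have /existsNP [q /not_implyP [Tq qa]] :
    ~ forall q, T q -> mxpoly_eval (mxeval F a) q = 0.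
  move=> Ua; have : (~` U) (mxeval F a) by rewrite UT.
  by apply; move: Ba; rewrite BU => -[].
have [P PE] := mxpoly_curve p F; have [Q QE] := mxpoly_curve q F.
have : P * Q = 0.
  apply: poly_eq0_horner => c; rewrite hornerM.
  have [-> _] := PE c; have [-> _] := QE c.
  have [Bc|nBc] := pselect (B (mxeval F c)).
    by move: (Bc); rewrite BC CS => -[_ /(_ _ Sp)->]; rewrite mul0r.
  have : (~` U) (mxeval F c) by move=> Uc; apply: nBc; rewrite BU; split.
  by rewrite UT => /(_ _ Tq)->; rewrite mulr0.
move=> /eqP; rewrite mulf_eq0 => /orP[/eqP P0|/eqP Q0].
  by apply: pb; have [<- _] := PE b; rewrite P0 horner0.
by apply: qa; have [<- _] := QE a; rewrite Q0 horner0.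
Qed.

Lemma zariski_connected_gl_closure S :
    gl_subgroup (generated_subgroup S) ->
    (forall A, S A -> exists F : 'M[{poly K}]_n,
      [/\ mxeval F 0 = 1%:M, mxeval F 1 = A
        & forall c, gl_closure (generated_subgroup S) (mxeval F c)]) ->
  zariski_connected (gl_closure (generated_subgroup S)).
Proof.
set H := generated_subgroup S => gH SF B [b Bb] oB cB.
have gN := gl_subgroup_closure gH; have [uN N1 NM NV] := gN.
set N := gl_closure H in SF gN uN N1 NM NV oB cB *.
have BN A : B A -> N A by case: cB => C _ -> [].
(* The right translations preserving both B and its complement in N form a subgroup, so only the
   generators need checking. *)
have HB A : H A -> N A /\ forall h, N h -> (B h <-> B (h *m A)).
  move=> HA; apply: (HA [set A | N A /\ forall h, N h -> (B h <-> B (h *m A))]).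
  split; first split=> [A' [/uN] //||A1 A2 [N1' B1] [N2 B2]|A' [NA' BA']].
  - by split=> // h Nh; rewrite mulmx1.
  - split; first exact: NM.
    by move=> h Nh; rewrite mulmxA -B2 -?B1 //; apply: NM.
  - split; first exact: NV.
    move=> h Nh; rewrite (BA' (h *m _)) ?mulmxKV ?uN //.
    by apply: NM => //; apply: NV.
  - move=> A' /SF [F [F0 F1 NF]]; split; first by rewrite -F1; apply: NF.
    (* This curve joins h to h A' inside N. *)
    move=> h Nh; pose E := map_mx polyC h *m F.
    have EE c : mxeval E c = h *m mxeval F c by rewrite mxevalM mxeval_const.
    have NE c : N (mxeval E c) by rewrite EE; apply: NM.
    rewrite -[X in B X <-> _]mulmx1 -F0 -F1 -!EE.
    by split; apply: (curve_clopen oB cB).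
apply/seteqP; split=> [A /BN //|A NA].
case: cB => C clC BC; rewrite BC; split=> //.
(* Since B is closed in N and contains bH, it contains the closure bN = N. *)
apply: (zariski_hull_sub_closed clC (S := C)) => //.
have Nb := BN b Bb; rewrite -(mulKVmx (uN b Nb) A).
have [hA _] : N (invmx b *m A) by apply: NM => //; apply: NV.
move: hA; apply: (zariski_hull_map (f := fun A => b *m A)).
  by move=> i j; apply: polyfun_mulmxl.
move=> h /HB [_ Bh]; apply: sub_zariski_hull.
by have := (Bh b Nb).1 Bb; rewrite BC => -[].
Qed.

(** Conjugation by A is a continuous group morphism, so it is enough to conjugate generators. *)
Lemma gl_closure_normal S G :
    algebraic_group G -> S `<=` G ->
    (forall A X, G A -> S X ->
      gl_closure (generated_subgroup S) (A *m X *m invmx A)) ->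
  normal_in (gl_closure (generated_subgroup S)) G.
Proof.
move=> aG SG nS; have gG := aG.1; have [uG G1 GM GV] := gG.
have HG := generated_subgroup_sub gG SG.
have NG := gl_closure_sub aG HG.
have gH := gl_subgroup_generated gG SG.
have [uN N1 NM NV] := gl_subgroup_closure gH.
split=> // A B GA NB; split; last first.
  by apply: uG; apply: (GM); [apply: GM => //; apply: NG | apply: GV].
have [hB _] := NB; move: hB.
apply: (zariski_hull_map (f := fun B => A *m B *m invmx A)).
  move=> i j.
  have [q qE] := polyfun_comp (polyfun_mulmxr (invmx A) i j) (polyfun_mulmxl A).
  by exists q => C; rewrite qE.
move=> h Hh.
suff [] : gl_closure (generated_subgroup S) (A *m h *m invmx A) by [].
have uA := uG A GA.
pose T := [set h | h \in unitmx /\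
  gl_closure (generated_subgroup S) (A *m h *m invmx A)].
suff [] : T h by [].
apply: Hh; split; last by move=> X SX; split; [apply/uG/SG | apply: nS].
split=> [B' [] //||B1 B2 [u1 n1] [u2 n2]|B1 [u1 n1]]; split.
- exact: unitmx1.
- by rewrite mulmx1 mulmxV.
- by rewrite unitmx_mul u1.
- have -> : A *m (B1 *m B2) *m invmx A =
    (A *m B1 *m invmx A) *m (A *m B2 *m invmx A) by rewrite !mulmxA mulmxKV.
  exact: NM.
- by rewrite unitmx_inv.
- have -> : A *m invmx B1 *m invmx A = invmx (A *m B1 *m invmx A).
    have uC : A *m B1 *m invmx A \in unitmx.
      by rewrite !unitmx_mul unitmx_inv uA u1.
    apply: (can_inj (mulKmx uC)); rewrite [RHS]mulmxV // !mulmxA.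
    by rewrite mulmxKV // mulmxK // mulmxV.
  exact: NV.
Qed.

(** * Connected groups with zero Lie algebra *)

(** The differentials at 1 of the equations of G span the cotangent space; independent ones are
    collected one row at a time. *)
Lemma lie_algebra0_jacobian G : (forall X, lie_algebra G X -> X = 0) ->
  forall r, (r <= n * n)%N -> exists2 M : 'M[K]_(r, n * n), row_free M &
    forall i, exists2 p, vanishes_on G p &
      forall k, M i k = mxpoly_eval 1%:M (mpoly.mderiv k p).
Proof.
move=> L0; elim=> [|r IH] rn.
  by exists (0 : 'M[K]_(0, n * n)) => [|[]//]; rewrite /row_free mxrank0.
have [M Mfree MG] := IH (ltnW rn).
(* Fewer than n^2 rows share a nonzero kernel vector v. It is not tangent to G, so some equation p
   has a differential nonzero on v. *)
have [v Mv v0] : exists2 v : 'cV_(n * n), M *m v = 0 & v != 0.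
  have : cokermx M != 0.
    by rewrite -mxrank_eq0 mxrank_coker (eqP Mfree) subn_eq0 -ltnNge.
  move=> /eqP/matrixP/existsNP[i /existsNP[j /eqP]]; rewrite mxE => ij.
  exists (col j (cokermx M)); first by rewrite colE mulmxA mulmx_coker mul0mx.
  by apply: contraNneq ij => /matrixP /(_ i 0); rewrite !mxE => ->.
have /existsNP [p /not_implyP [Gp pv]] : ~ lie_algebra G (vec_mx v^T).
  move=> /L0 /(congr1 mxvec); rewrite vec_mxK linear0 => /(congr1 trmx).
  by rewrite trmxK trmx0 => v00; rewrite v00 eqxx in v0.
pose g : 'rV_(n * n) := \row_k mxpoly_eval 1%:M (mpoly.mderiv k p).
have gv : (g *m v) 0 0 != 0.
  apply/eqP => gv; apply: pv; rewrite -[RHS]gv mxE; apply: eq_bigr => k _.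
  by rewrite vec_mxK !mxE.
exists (col_mx g M : 'M[K]_(1 + r, n * n)).
  apply: (@inj_row_free K (1 + r) _ (col_mx g M)) => w.
  rewrite -[w]hsubmxK mul_row_col => wM.
  (* Applying a relation between the rows to v kills the old rows and isolates the coefficient of
     g. *)
  have /matrixP /(_ 0 0) : lsubmx w *m (g *m v) = 0.
    have /(congr1 (mulmx^~ v)) := wM.
    by rewrite mulmxDl -!mulmxA Mv mulmx0 addr0 mul0mx.
  rewrite mxE big_ord1 [RHS]mxE => /eqP.
  rewrite mulf_eq0 (negPf gv) orbF => /eqP l0.
  have lw : lsubmx w = 0 by apply/matrixP => i j; rewrite !ord1 l0 mxE.
  move: wM; rewrite lw mul0mx add0r => /eqP.
  rewrite mulmx_free_eq0 // => /eqP ->.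
  by rewrite row_mx0.
move=> i; case: (splitP (i : 'I_(1 + r))) => [j|j] ij.
  exists p => // k; have -> : i = lshift r j by apply: val_inj.
  by rewrite [LHS](col_mxEu g M) !mxE.
have [q Gq qE] := MG j; exists q => // k.
have -> : i = rshift 1 j by apply: val_inj.
by rewrite [LHS](col_mxEd g M).
Qed.

Lemma zariski_closed1 A : @closed (zariski_mx K n) [set A].
Proof.
apply/zariski_closedP; exists [set p | mxpoly_eval A p = 0].
apply/seteqP; split=> [_ -> //|B AB].
apply/matrixP => i j; apply/eqP; rewrite -subr_eq0; apply/eqP.
have := AB (mxpolyX K i j + mpoly.mpolyC _ (- A i j)).
rewrite /= !mxpoly_evalD !mxpoly_evalX !mxpoly_evalC; apply.
by rewrite subrr.
Qed.

(* Nakayama: if the differentials at 1 of the polynomials vanishing on G span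
   the cotangent space, then n^2 of them can be written as T(A) (A - 1) with
   det T(1) != 0, so 1 is the only point of G where det T does not vanish. *)
Lemma lie_algebra0_trivial G : gl_subgroup G -> zariski_connected G ->
  (forall X, lie_algebra G X -> X = 0) -> G = [set 1%:M].
Proof.
move=> [_ G1 _ _] cG L0.
have [M Mfree MG] := lie_algebra0_jacobian L0 (leqnn _).
have /choice[T TE] : forall i, exists T : 'I_(n * n) -> mp,
    (forall A, G A ->
      \sum_k mxpoly_eval A (T k) * mxvec (A - 1%:M) ord0 k = 0) /\
    (forall k, mxpoly_eval 1%:M (T k) = M i k).
  move=> i; have [p Gp pE] := MG i.
  have [T [T1 T2]] := mxpoly_taylor1 1%:M p; exists T; split=> [A GA|k].
    by have := T1 A; rewrite !Gp // add0r.
  have delta (f : 'I_(n * n) -> K) :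
      \sum_l f l * mxvec (vec_mx (delta_mx 0 k) : 'M[K]_n) ord0 l = f k.
    rewrite (bigD1 k) //= big1 ?addr0 => [|l lk];
      rewrite vec_mxK mxE eqxx ?eqxx.
      by rewrite mulr1.
    by rewrite (negPf lk) mulr0.
  rewrite pE -[LHS](delta (fun l => mxpoly_eval 1%:M (T l))) -T2.
  exact: (delta (fun l => mxpoly_eval 1%:M (mpoly.mderiv l p))).
pose Tm A : 'M[K]_(n * n) := \matrix_(i, k) mxpoly_eval A (T i k).
have [d dE] : polyfun (fun A => \det (Tm A)).
  apply: polyfun_det => i k; exists (T i k) => A; by rewrite mxE.
(* Connectedness is applied to the subset formed by 1 alone, shown open and then closed in G. *)
symmetry; apply: cG; first by exists 1%:M.
- exists [set A | mxpoly_eval A d != 0].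
    apply/zariski_openP; exists [set d]; apply/seteqP; split=> A /=.
      by move=> /negP; rewrite negbK => /eqP ? _ ->.
    by move=> /(_ _ erefl) ->; rewrite eqxx.
  apply/seteqP; split=> [_ ->|A [GA /= dA]].
    split=> //=; rewrite dE; have -> : Tm 1%:M = M.
      by apply/matrixP => i k; rewrite mxE; have [_ ->] := TE i.
    by rewrite -unitfE -unitmxE -row_free_unit.
  have uT : Tm A \in unitmx by rewrite unitmxE unitfE -dE.
  have : Tm A *m (mxvec (A - 1%:M))^T = 0.
    apply/matrixP => i j; rewrite [LHS]mxE [RHS]mxE.
    have [/(_ A GA) Ti _] := TE i.
    rewrite -[RHS]Ti; apply: eq_bigr => k _.
    by rewrite [Tm A i k]mxE [(mxvec _)^T k j]mxE ord1.
  move=> /(congr1 (mulmx (invmx (Tm A)))); rewrite mulKmx // mulmx0.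
  move=> /(congr1 trmx); rewrite trmxK trmx0 => /(congr1 vec_mx).
  by rewrite mxvecK linear0 => /eqP; rewrite subr_eq0 => /eqP.
- exists [set 1%:M]; first exact: zariski_closed1.
  by apply/seteqP; split=> [_ ->|A []].
Qed.

(** * Density of the generated subgroup *)

Lemma texp_generated_dense G m (x y : 'M[K]_n) (t s : K) :
    simple_algebraic_group G ->
    lie_algebra G x -> lie_algebra G y ->
    x ^+ m.+1 = 0 -> y ^+ m.+1 = 0 ->
    lie_algebra G `<=` generated_lie_algebra [set x; y] ->
    t != 0 -> s != 0 ->
  zariski_dense_in
    (generated_subgroup [set texp m.+1 (t *: x); texp m.+1 (s *: y)]) G.
Proof.
move=> [aG cG [A0 [B0 [GA0 GB0 AB0]]] simpleG] Lx Ly xm ym gen t0 s0.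
have gG := aG.1; have [uG _ _ _] := gG.
set S := [set _; _]; set H := generated_subgroup S.
have SG : S `<=` G by move=> _ [->|->]; apply: texp_lie_algebra.
have gH : gl_subgroup H := gl_subgroup_generated gG SG.
have HG : H `<=` G := generated_subgroup_sub gG SG.
have aN := algebraic_group_closure gH; have gN := aN.1.
have Nx c : gl_closure H (texp m.+1 (c *: x)).
  by apply: (texp_gl_closure c gH xm t0); apply: sub_generated_subgroup; left.
have Ny c : gl_closure H (texp m.+1 (c *: y)).
  by apply: (texp_gl_closure c gH ym s0); apply: sub_generated_subgroup; right.
have LGN : lie_algebra G `<=` lie_algebra (gl_closure H).
  by move=> Z /gen; apply: generated_lie_algebra_sub gN xm Nx ym Ny Z.
have cN : zariski_connected (gl_closure H).
  apply: zariski_connected_gl_closure => // _ [->|->].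
    exists (texp_curve m.+1 (t *: x)); split=> [||c].
    - by rewrite mxeval_texp scale0r texp0.
    - by rewrite mxeval_texp scale1r.
    - by rewrite mxeval_texp scalerA.
  exists (texp_curve m.+1 (s *: y)); split=> [||c].
  - by rewrite mxeval_texp scale0r texp0.
  - by rewrite mxeval_texp scale1r.
  - by rewrite mxeval_texp scalerA.
have nN : normal_in (gl_closure H) G.
  apply: gl_closure_normal => // A X GA; have uA := uG A GA.
  by case=> ->; rewrite texp_conj //; apply: texp_lie_algebra aN _ _;
    rewrite ?nilpotent_conj //; apply: LGN; apply: lie_algebra_conj.
have [N1|NG] := simpleG _ aN cN nN; last first.
  by split=> // A; rewrite -NG => -[hA _]; apply: zariski_hull_sub_closure.
case: AB0; have L0 X : lie_algebra G X -> X = 0.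
  move=> /LGN LX; apply/matrixP => i j; rewrite mxE.
  (* These equations of the point 1 have the coordinates as differentials, so the Lie algebra of the
     trivial group is zero. *)
  have := LX (mxpolyX K i j + mpoly.mpolyC _ (- (1%:M : 'M[K]_n) i j)).
  rewrite mxpoly_diffD mxpoly_diffX mxpoly_diffC addr0; apply => A.
  rewrite N1 => ->.
  by rewrite mxpoly_evalD mxpoly_evalX mxpoly_evalC subrr.
have G1 := lie_algebra0_trivial gG cG L0.
by move: GA0 GB0; rewrite G1 => -> ->.
Qed.

End ClosedSubgroups.

(** * From truncated sums to the matrix exponential *)

(** It makes limits unique. Matrices of positive dimensions are normed; otherwise the space is a
    single point. *)
Lemma hausdorff_mx (K : numFieldType) (m n : nat) :
  hausdorff_space 'M[K]_(m, n).
Proof.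
case: m => [|m].
  by move=> p q _; apply/matrixP => -[].
case: n => [|n]; last exact: norm_hausdorff.
by move=> p q _; apply/matrixP => i [].
Qed.

(** The partial sums of the series are constant from index m on. *)
Lemma expmx_nilpotent (K : numClosedFieldType) (n m : nat) (X : 'M[K]_n) :
  X ^+ m = 0 -> expmx X = texp m X.
Proof.
move=> Xm; apply: lim_near_cst; first exact: hausdorff_mx.
exists m => // k /= mk; rewrite /series /= -(subnKC mk) /index_iota subn0.
rewrite iotaD big_cat /= add0n [X in _ + X]big1_seq ?addr0.
  by rewrite -[in iota 0 m](subn0 m) -/(index_iota 0 m) big_mkord.
move=> i /andP[_]; rewrite mem_iota => /andP[mi _].
by rewrite -(subnK mi) exprD Xm mulr0 scaler0.
Qed.

Lemma expmx_generated_dense (K : numClosedFieldType) (n : nat)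
    (G : set 'M[K]_n) (x y : 'M[K]_n) (t s : K) :
    simple_algebraic_group G ->
    lie_algebra G x -> lie_algebra G y ->
    nilpotent_mx x -> nilpotent_mx y ->
    lie_algebra G `<=` generated_lie_algebra [set x; y] ->
    t != 0 -> s != 0 ->
  zariski_dense_in
    (generated_subgroup [set expmx (t *: x); expmx (s *: y)]) G.
Proof.
move=> simpleG gx gy [k xk] [l yl] gen t0 s0.
(* A common exponent for x and y, made positive to fit [m.+1]. *)
have xm : x ^+ (k + l).+1 = 0 by rewrite -addnS exprD xk mul0r.
have ym : y ^+ (k + l).+1 = 0 by rewrite -addSn exprD yl mulr0.
rewrite !(@expmx_nilpotent _ _ (k + l).+1) ?exprZmx ?xm ?ym ?scaler0 //.
exact: texp_generated_dense.
Qed.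

Theorem proposition3p1 (R : realType) (n : nat) (G : set 'M[R[i]]_n)
  (simpleG : simple_algebraic_group G)
  (x y : 'M[R[i]]_n)
  (gx : lie_algebra G x) (gy : lie_algebra G y)
  (nilx : nilpotent_mx x) (nily : nilpotent_mx y)
  (gen : generated_lie_algebra [set x; y] = lie_algebra G)
  (t s : R[i]) (t0 : t != 0) (s0 : s != 0) :
  zariski_dense_in
    (generated_subgroup [set expmx (t *: x); expmx (s *: y)]) G.
Proof.
have sub : lie_algebra G `<=` generated_lie_algebra [set x; y] by rewrite gen.
exact: (@expmx_generated_dense R[i] n G x y t s simpleG gx gy nilx nily sub).
Qed.
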